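(* Let $R$ be a noetherian commutative ring. Then every finite sequence $\underline s=(s_1,\ldots,s_r)$ of elements of $R$ is Koszul-complete; that is, for $I=\langle s_1,\ldots,s_r\rangle$ and $\hat R=\lim_nR/I^n$, the canonical map $R\to\hat R$ induces a quasi-isomorphism $\mathrm{kos}(\underline s)\to\mathrm{kos}(\underline s)\otimes_R\hat R$.
   Context: $\mathrm{kos}(\underline s)=\bigotimes_{i=1}^r\operatorname{cone}(s_i\colon R\to R)$ is the usual Koszul complex over $R$. *)

(* Defs.v *)
From HB Require Import structures.
From mathcomp Require Import all_boot all_order all_algebra.
From mathcomp Require Import finmap.
From mathcomp Require Import boolp classical_sets functions cardinality.

Set Implicit Arguments.
Unset Strict Implicit.
Unset Printing Implicit Defensive.

Import GRing.Theory.

Local Open Scope classical_set_scope.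
Local Open Scope ring_scope.
Local Open Scope quotient_scope.

(* Rings are [comPzRingType]s, so that the zero ring is allowed.
   Complexes are cohomologically graded by [int]: differentials raise the
   degree by one, and the cone of [R -> R] lives in degrees -1 and 0. *)

Section Submodules.
Variables (R : pzRingType) (M : lmodType R).

Definition submodule (N : set M) : Prop :=
  N 0 /\ forall (a : R) x y, N x -> N y -> N (a *: x + y).

Definition span (S : set M) : set M := smallest submodule S.

Lemma span_submodule (S : set M) : submodule (span S).
Proof.
split=> [A [[A0 _] _] //|a x y Sx Sy A /[dup] AP [[_ AL] _]].
by apply: AL; [exact: Sx|exact: Sy].
Qed.

Lemma sub_span (S : set M) : S `<=` span S.
Proof. exact: sub_gen_smallest. Qed.

Lemma span_min (S N : set M) : submodule N -> S `<=` N -> span S `<=` N.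
Proof. by move=> sN SN; apply: smallest_sub. Qed.

Lemma span0 S : span S 0. Proof. by case: (span_submodule S). Qed.

Lemma spanP S a x y : span S x -> span S y -> span S (a *: x + y).
Proof. by case: (span_submodule S) => _; apply. Qed.

Lemma spanD S x y : span S x -> span S y -> span S (x + y).
Proof. by move=> Sx Sy; rewrite -[x]scale1r; apply: spanP. Qed.

Lemma spanZ S a x : span S x -> span S (a *: x).
Proof. by move=> Sx; rewrite -[_ *: _]addr0; apply: spanP => //; exact: span0. Qed.

Lemma spanN S x : span S x -> span S (- x).
Proof. by move=> Sx; rewrite -scaleN1r; apply: spanZ. Qed.

End Submodules.

(* The quotient of [M] by the submodule generated by [S]. *)
Section Quotient.
Variables (R : pzRingType) (M : lmodType R) (S : set M).

Definition quot_rel (x y : M) : bool := `[< span S (x - y) >].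

Lemma quot_rel_refl : reflexive quot_rel.
Proof. by move=> x; apply/asboolP; rewrite subrr; apply: span0. Qed.

Lemma quot_rel_sym : symmetric quot_rel.
Proof.
by move=> x y; apply/asboolP/asboolP => /spanN; rewrite opprB.
Qed.

Lemma quot_rel_trans : transitive quot_rel.
Proof.
move=> y x z /asboolP xy /asboolP yz; apply/asboolP.
by rewrite -(subrK y x) -addrA; apply: spanD.
Qed.

Definition quot_equiv :=
  EquivRel quot_rel quot_rel_refl quot_rel_sym quot_rel_trans.

Definition quot : Type := {eq_quot quot_equiv}.

HB.instance Definition _ := Choice.on quot.
HB.instance Definition _ := EqQuotient.on quot.

Lemma quot_eqP (x y : M) : (\pi_quot x = \pi_quot y) <-> span S (x - y).
Proof.
split=> [/eqmodP/asboolP //|h]; by apply/eqmodP/asboolP.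
Qed.

Lemma quot_repr (x : M) : span S (repr (\pi_quot x) - x).
Proof. by apply/quot_eqP; rewrite reprK. Qed.

Definition quot_add (u v : quot) : quot := \pi_quot (repr u + repr v).
Definition quot_opp (u : quot) : quot := \pi_quot (- repr u).
Definition quot_scale (a : R) (u : quot) : quot := \pi_quot (a *: repr u).

Lemma pi_quot_add x y :
  quot_add (\pi_quot x) (\pi_quot y) = \pi_quot (x + y).
Proof.
apply/quot_eqP; rewrite opprD addrACA.
by apply: spanD; apply: quot_repr.
Qed.

Lemma pi_quot_opp x : quot_opp (\pi_quot x) = \pi_quot (- x).
Proof. by apply/quot_eqP; rewrite -opprD; apply: spanN; apply: quot_repr. Qed.

Lemma pi_quot_scale a x : quot_scale a (\pi_quot x) = \pi_quot (a *: x).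
Proof. by apply/quot_eqP; rewrite -scalerBr; apply: spanZ; apply: quot_repr. Qed.

Lemma quot_ind (P : quot -> Prop) : (forall x, P (\pi_quot x)) -> forall u, P u.
Proof. by move=> h u; rewrite -[u]reprK; apply: h. Qed.

Lemma quot_addA : associative quot_add.
Proof.
move=> u v w; elim/quot_ind: u => u; elim/quot_ind: v => v.
by elim/quot_ind: w => w; rewrite !pi_quot_add addrA.
Qed.

Lemma quot_addC : commutative quot_add.
Proof.
move=> u v; elim/quot_ind: u => u; elim/quot_ind: v => v.
by rewrite !pi_quot_add addrC.
Qed.

Lemma quot_add0 : left_id (\pi_quot 0) quot_add.
Proof. by move=> u; elim/quot_ind: u => u; rewrite !pi_quot_add add0r. Qed.

Lemma quot_addN : left_inverse (\pi_quot 0) quot_opp quot_add.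
Proof. by move=> u; elim/quot_ind: u => u; rewrite pi_quot_opp pi_quot_add addNr. Qed.

HB.instance Definition _ :=
  GRing.isZmodule.Build quot quot_addA quot_addC quot_add0 quot_addN.

Let pi_addE (x y : M) : \pi_quot x + \pi_quot y = \pi_quot (x + y) :> quot.
Proof. exact: pi_quot_add. Qed.

Lemma quot_scaleA a b (v : quot) :
  quot_scale a (quot_scale b v) = quot_scale (a * b) v.
Proof. by elim/quot_ind: v=> v; rewrite !pi_quot_scale scalerA. Qed.

Lemma quot_scale1 : left_id 1 quot_scale.
Proof. by move=> u; elim/quot_ind: u => u; rewrite !pi_quot_scale scale1r. Qed.

Lemma quot_scaleDr : right_distributive quot_scale +%R.
Proof.
move=> a u v; elim/quot_ind: u => u; elim/quot_ind: v => v.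
by rewrite pi_addE !pi_quot_scale pi_addE scalerDr.
Qed.

Lemma quot_scaleDl v : {morph quot_scale^~ v : a b / a + b}.
Proof.
move=> a b; elim/quot_ind: v => v.
by rewrite !pi_quot_scale pi_addE scalerDl.
Qed.

HB.instance Definition _ := GRing.Zmodule_isLmodule.Build R quot
  quot_scaleA quot_scale1 quot_scaleDr quot_scaleDl.

Definition qpi (x : M) : quot := \pi_quot x.

Lemma qpi_is_linear : linear qpi.
Proof.
move=> a x y; rewrite /qpi.
rewrite [RHS](_ : _ = quot_add (quot_scale a (\pi_quot x)) (\pi_quot y)) //.
by rewrite pi_quot_scale pi_quot_add.
Qed.
HB.instance Definition _ := GRing.isLinear.Build R M quot _ qpi qpi_is_linear.

Lemma qpi_eq (x y : M) : qpi x = qpi y <-> span S (x - y).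
Proof. exact: quot_eqP. Qed.

Lemma qpi_eq0 (x : M) : qpi x = 0 <-> span S x.
Proof. by rewrite -(raddf0 qpi) qpi_eq subr0. Qed.

Lemma qpi_ind (P : quot -> Prop) : (forall x, P (qpi x)) -> forall u, P u.
Proof. exact: quot_ind. Qed.

Section Lift.
Variables (P : lmodType R) (f : {linear M -> P}).

(* The hypothesis only serves to make the linear structure inferable. *)
Definition quot_lift (_ : forall x, S x -> f x = 0) (u : quot) : P := f (repr u).

Variable f0 : forall x, S x -> f x = 0.
Local Notation lift := (quot_lift f0).

Lemma quot_liftE x : lift (qpi x) = f x.
Proof.
have sk : submodule [set x | f x = 0].
  by split=> [|a u v /= fu fv]; rewrite /= ?raddf0 // linearP fu fv scaler0 addr0.
apply/eqP; rewrite -subr_eq0 -raddfB; apply/eqP.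
exact: (span_min sk f0) (quot_repr x).
Qed.

Lemma quot_lift_is_linear : linear lift.
Proof.
move=> a u v; elim/qpi_ind: u => x; elim/qpi_ind: v => y.
by rewrite -linearP !quot_liftE linearP.
Qed.
HB.instance Definition _ :=
  GRing.isLinear.Build R quot P _ lift quot_lift_is_linear.

End Lift.

End Quotient.

Arguments qpi {R M} S x.

Lemma qpi_ext (R : pzRingType) (M P : lmodType R) (S : set M)
    (f g : {linear quot S -> P}) :
  (forall x, f (qpi S x) = g (qpi S x)) -> forall u, f u = g u.
Proof. by move=> h; elim/qpi_ind. Qed.

Section DirectProduct.
Variables (R : pzRingType) (J : Type) (M : J -> lmodType R).

Definition dprod : Type := forall j, M j.
Identity Coercion dprod_fun : dprod >-> Funclass.

HB.instance Definition _ := gen_eqMixin dprod.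
HB.instance Definition _ := gen_choiceMixin dprod.

Definition dprod_add (f g : dprod) : dprod := fun j => f j + g j.
Definition dprod_opp (f : dprod) : dprod := fun j => - f j.
Definition dprod_scale (a : R) (f : dprod) : dprod := fun j => a *: f j.

Lemma dprodP (f g : dprod) : (forall j, f j = g j) -> f = g.
Proof. exact: functional_extensionality_dep. Qed.

Lemma dprod_addA : associative dprod_add.
Proof. by move=> f g h; apply: dprodP => j; apply: addrA. Qed.
Lemma dprod_addC : commutative dprod_add.
Proof. by move=> f g; apply: dprodP => j; apply: addrC. Qed.
Lemma dprod_add0 : left_id (fun=> 0) dprod_add.
Proof. by move=> f; apply: dprodP => j; apply: add0r. Qed.
Lemma dprod_addN : left_inverse (fun=> 0) dprod_opp dprod_add.
Proof. by move=> f; apply: dprodP => j; apply: addNr. Qed.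

HB.instance Definition _ :=
  GRing.isZmodule.Build dprod dprod_addA dprod_addC dprod_add0 dprod_addN.

Lemma dprod_scaleA a b f :
  dprod_scale a (dprod_scale b f) = dprod_scale (a * b) f.
Proof. by apply: dprodP => j; apply: scalerA. Qed.
Lemma dprod_scale1 : left_id 1 dprod_scale.
Proof. by move=> f; apply: dprodP => j; apply: scale1r. Qed.
Lemma dprod_scaleDr : right_distributive dprod_scale +%R.
Proof. by move=> a f g; apply: dprodP => j; apply: scalerDr. Qed.
Lemma dprod_scaleDl f : {morph dprod_scale^~ f : a b / a + b}.
Proof. by move=> a b; apply: dprodP => j; apply: scalerDl. Qed.

HB.instance Definition _ := GRing.Zmodule_isLmodule.Build R dprod
  dprod_scaleA dprod_scale1 dprod_scaleDr dprod_scaleDl.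

Lemma dprod0E j : (0 : dprod) j = 0. Proof. by []. Qed.
Lemma dprodDE (f g : dprod) j : (f + g) j = f j + g j. Proof. by []. Qed.
Lemma dprodZE a (f : dprod) j : (a *: f) j = a *: f j. Proof. by []. Qed.

End DirectProduct.

(* The direct sum, as finitely supported families. *)
Section DirectSum.
Variables (R : pzRingType) (J : choiceType) (M : J -> lmodType R).

Definition supp (f : dprod M) : set J := [set j | f j <> 0].

Definition finsupp : pred (dprod M) := fun f => `[< finite_set (supp f) >].

Lemma finsupp_submod : submod_closed finsupp.
Proof.
split=> [|a f g /asboolP ff /asboolP fg]; apply/asboolP.
  by rewrite (_ : supp 0 = set0) // -subset0 => j /=.
apply: (@sub_finite_set _ _ (supp f `|` supp g)); last by rewrite finite_setU.
move=> j /= h; apply: contrapT => /not_orP[/contrapT f0 /contrapT g0].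
by apply: h; rewrite dprodDE dprodZE f0 g0 scaler0 addr0.
Qed.
HB.instance Definition _ :=
  GRing.isSubmodClosed.Build R (dprod M) finsupp finsupp_submod.

Record dsum : Type := DSum { dsum_val :> dprod M; dsumP : dsum_val \in finsupp }.

HB.instance Definition _ := [isSub for dsum_val].
HB.instance Definition _ := [Choice of dsum by <:].
HB.instance Definition _ := [SubChoice_isSubLmodule of dsum by <:].

Lemma dsum_ext (f g : dsum) : (forall j, f j = g j) -> f = g.
Proof. by move=> h; apply/val_inj/dprodP. Qed.

Lemma dsum_fin (f : dsum) : finite_set (supp f).
Proof. by have /asboolP := dsumP f. Qed.

Definition inj_val (j : J) (x : M j) : dprod M := fun i =>
  if j =P i is ReflectT e then ecast k (M k) e x else 0.

Lemma inj_val_finsupp j (x : M j) : inj_val x \in finsupp.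
Proof.
apply/asboolP/(@sub_finite_set _ _ [set j]) => // i /=.
by rewrite /supp /inj_val /=; case: (j =P i) => [e _|_ /(_ erefl)] //; rewrite e.
Qed.

Definition inj (j : J) (x : M j) : dsum := DSum (inj_val_finsupp x).

Lemma injE j (x : M j) : inj x j = x.
Proof. by rewrite /= /inj_val; case: (j =P j) => // e; rewrite eq_axiomK. Qed.

Lemma inj_neq j (x : M j) i : j <> i -> inj x i = 0.
Proof. by rewrite /= /inj_val; case: (j =P i). Qed.

Lemma inj_is_linear j : linear (@inj j).
Proof.
move=> a x y; apply: dsum_ext => i /=; rewrite dprodDE dprodZE /inj_val.
by case: (j =P i) => [e|_]; [case: _ / e | rewrite scaler0 addr0].
Qed.
HB.instance Definition _ j :=
  GRing.isLinear.Build R (M j) dsum _ (@inj j) (@inj_is_linear j).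

Section Lift.
Variables (P : lmodType R) (phi : forall j, {linear M j -> P}).

Definition dsum_lift (f : dsum) : P :=
  \sum_(j <- fset_set (supp f)) phi j (f j).

Lemma dsum_liftE_sub (A : {fset J}) (f : dsum) : supp f `<=` [set` A] ->
  dsum_lift f = \sum_(j <- A) phi j (f j).
Proof.
move=> sA; rewrite /dsum_lift [RHS](bigID (mem (fset_set (supp f)))) /=.
rewrite [X in _ + X]big1 ?addr0; last first.
  move=> j /negP; rewrite in_fset_set; last exact: dsum_fin.
  by rewrite inE => /contrapT ->; rewrite raddf0.
rewrite -[RHS]big_filter; apply: perm_big; apply: uniq_perm => //.
  by rewrite filter_uniq.
move=> j; rewrite mem_filter; case: (boolP (j \in fset_set _)) => //=.
rewrite in_fset_set; last exact: dsum_fin.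
by move=> /set_mem sj; have /= -> := sA _ sj.
Qed.

Lemma dsum_lift_is_linear : linear dsum_lift.
Proof.
move=> a f g.
pose A := (fset_set (supp f) `|` fset_set (supp g))%fset.
have sf : supp f `<=` [set` A].
  by move=> j sj /=; rewrite inE in_fset_set ?mem_set //; exact: dsum_fin.
have sg : supp g `<=` [set` A].
  move=> j sj /=; rewrite inE orbC in_fset_set ?mem_set //; exact: dsum_fin.
rewrite (@dsum_liftE_sub A f) // (@dsum_liftE_sub A g) //.
rewrite (@dsum_liftE_sub A); last first.
  move=> j /= h; have [fj|/sf //] := pselect (f j = 0).
  have [gj|/sg //] := pselect (g j = 0).
  by case: h; rewrite dprodDE dprodZE fj gj scaler0 addr0.
rewrite scaler_sumr -big_split /=; apply: eq_bigr => j _.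
by rewrite dprodDE dprodZE linearP.
Qed.
HB.instance Definition _ :=
  GRing.isLinear.Build R dsum P _ dsum_lift dsum_lift_is_linear.

Lemma dsum_lift_inj j (x : M j) : dsum_lift (inj x) = phi j x.
Proof.
rewrite (@dsum_liftE_sub [fset j]%fset) ?big_seq_fset1 ?injE //.
move=> i /= h; rewrite inE eq_sym; apply/eqP; apply: contrapT => ji.
by apply: h; apply: (inj_neq x).
Qed.

End Lift.

Lemma dsum_decomp (f : dsum) : f = \sum_(j <- fset_set (supp f)) inj (f j).
Proof.
apply: dsum_ext => i.
pose ev (g : dsum) : M i := g i.
have evD : {morph ev : x y / x + y >-> x + y} by move=> x y; rewrite /ev.
rewrite -[RHS]/(ev _) (big_morph ev evD (erefl : ev 0 = 0)) /ev.
have [si|/contrapT f0] := pselect (supp f i).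
  have ii : i \in fset_set (supp f).
    by rewrite in_fset_set ?mem_set //; exact: dsum_fin.
  rewrite (bigD1_seq i) // injE big1; first exact/esym/addr0.
  move=> j /eqP ji.
  exact: (inj_neq (f j)).
rewrite f0 big1_seq // => j /andP[_]; rewrite in_fset_set; last exact: dsum_fin.
move=> /set_mem sj; apply: (inj_neq (f j)) => ji.
by apply: sj; rewrite ji.
Qed.

Lemma dsum_ind_ext (P : lmodType R) (f g : {linear dsum -> P}) :
  (forall j (x : M j), f (inj x) = g (inj x)) -> forall u, f u = g u.
Proof.
move=> h u; rewrite [u]dsum_decomp !linear_sum.
by apply: eq_bigr => j _; apply: h.
Qed.

End DirectSum.

Arguments inj {R J M} j x.

Section Free.
Variables (R : pzRingType) (T : choiceType).

Definition free : lmodType R := dsum (fun _ : T => R^o : lmodType R).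

Definition gen (t : T) : free := inj t (1 : R^o).

End Free.

Arguments gen {R T} t.

(* [M (x) N]: the free module on [M * N] modulo the bilinearity relations. *)
Section Tensor.
Variables (R : comPzRingType) (M N : lmodType R).

Let e (x : M) (y : N) : free R (M * N)%type := gen (x, y).

Inductive bilin_rel : free R (M * N)%type -> Prop :=
| BilinDl x x' y : bilin_rel (e (x + x') y - (e x y + e x' y))
| BilinDr x y y' : bilin_rel (e x (y + y') - (e x y + e x y'))
| BilinZl a x y : bilin_rel (e (a *: x) y - a *: e x y)
| BilinZr a x y : bilin_rel (e x (a *: y) - a *: e x y).

Definition tensor : lmodType R := quot bilin_rel.

Definition tmul (x : M) (y : N) : tensor := qpi bilin_rel (e x y).

Lemma tmulDl x x' y : tmul (x + x') y = tmul x y + tmul x' y.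
Proof. by rewrite -raddfD; apply/qpi_eq; apply: sub_span; exact: BilinDl. Qed.
Lemma tmulDr x y y' : tmul x (y + y') = tmul x y + tmul x y'.
Proof. by rewrite -raddfD; apply/qpi_eq; apply: sub_span; exact: BilinDr. Qed.
Lemma tmulZl a x y : tmul (a *: x) y = a *: tmul x y.
Proof. by rewrite -linearZ; apply/qpi_eq; apply: sub_span; exact: BilinZl. Qed.
Lemma tmulZr a x y : tmul x (a *: y) = a *: tmul x y.
Proof. by rewrite -linearZ; apply/qpi_eq; apply: sub_span; exact: BilinZr. Qed.
Lemma tmul0l y : tmul 0 y = 0.
Proof. by rewrite -(scale0r 0) tmulZl scale0r. Qed.
Lemma tmul0r x : tmul x 0 = 0.
Proof. by rewrite -(scale0r 0) tmulZr scale0r. Qed.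

Lemma tensor_ext (P : lmodType R) (f g : {linear tensor -> P}) :
  (forall x y, f (tmul x y) = g (tmul x y)) -> forall u, f u = g u.
Proof.
move=> h; apply: qpi_ext => v.
apply: (dsum_ind_ext (f := f \o qpi bilin_rel : {linear _ -> P})
  (g := g \o qpi bilin_rel : {linear _ -> P})) => -[x y] a /=.
have -> : inj (x, y) a = a *: e x y :> free R (M * N)%type.
  by rewrite /e /gen -linearZ /= /GRing.scale /= mulr1.
by rewrite !linearZ /= h.
Qed.

End Tensor.

Section TensorMap.
Variables (R : comPzRingType) (M N M' N' : lmodType R).
Variables (f : {linear M -> M'}) (g : {linear N -> N'}).

Section Coeff.
Variables (P : lmodType R) (v : P).
Definition coeff (a : R^o) : P := a *: v.
Lemma coeff_is_linear : linear coeff.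
Proof. by move=> a x y; rewrite /coeff scalerDl scalerA. Qed.
HB.instance Definition _ :=
  GRing.isLinear.Build R R^o P _ coeff coeff_is_linear.
End Coeff.

Definition tensor_map_free (u : free R (M * N)%type) : tensor M' N' :=
  dsum_lift (fun p : M * N => coeff (tmul (f p.1) (g p.2)) : {linear R^o -> _}) u.
HB.instance Definition _ := GRing.Linear.copy tensor_map_free
  (dsum_lift (fun p : M * N => coeff (tmul (f p.1) (g p.2)) : {linear R^o -> _})).

Lemma tensor_map_gen x y : tensor_map_free (gen (x, y)) = tmul (f x) (g y).
Proof. by rewrite /tensor_map_free dsum_lift_inj /= /coeff scale1r. Qed.

Lemma tensor_map_rel u : bilin_rel u -> tensor_map_free u = 0.
Proof.
case=> [x x' y|x y y'|a x y|a x y];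
  by apply/eqP; rewrite raddfB subr_eq0 /= ?raddfD ?linearZ /= !tensor_map_gen
    ?raddfD ?linearZ /= ?tmulDl ?tmulDr ?tmulZl ?tmulZr.
Qed.

Definition tensor_map : tensor M N -> tensor M' N' := quot_lift tensor_map_rel.
HB.instance Definition _ :=
  GRing.Linear.copy tensor_map (quot_lift tensor_map_rel).

Lemma tensor_mapE x y : tensor_map (tmul x y) = tmul (f x) (g y).
Proof. by rewrite /tensor_map quot_liftE; apply: tensor_map_gen. Qed.

End TensorMap.

Section Complexes.
Variable R : pzRingType.

Record complex := Complex {
  cobj :> int -> lmodType R;
  cdiff : forall n, {linear cobj n -> cobj (n + 1)};
  cdiffK : forall n x, cdiff (n + 1) (cdiff n x) = 0
}.

Record chain_map (C D : complex) := ChainMap {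
  cmap :> forall n, {linear C n -> D n};
  cmapP : forall n x, cmap (n + 1) (cdiff C n x) = cdiff D n (cmap n x)
}.

(* The module [M] placed in degree 0. *)
Section Stalk.
Variable M : lmodType R.

Definition stalk_obj (n : int) : lmodType R :=
  if n is Posz 0 then M else 'rV[R]_0.

Definition stalk_diff (n : int) (x : stalk_obj n) : stalk_obj (n + 1) := 0.

Lemma stalk_diff_is_linear n : linear (@stalk_diff n).
Proof. by move=> a x y; rewrite /stalk_diff scaler0 addr0. Qed.
HB.instance Definition _ n := GRing.isLinear.Build R (stalk_obj n)
  (stalk_obj (n + 1)) _ (@stalk_diff n) (@stalk_diff_is_linear n).

Definition stalk : complex :=
  @Complex stalk_obj (fun n => @stalk_diff n) (fun _ _ => erefl).

End Stalk.

Section StalkMap.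
Variables (M N : lmodType R) (f : {linear M -> N}).

Definition stalk_fun (n : int) : {linear stalk M n -> stalk N n} :=
  match n return {linear stalk_obj M n -> stalk_obj N n} with
  | Posz 0 => f
  | _ => \0
  end.

Lemma stalk_funP n x :
  stalk_fun (n + 1) (cdiff (stalk M) n x) = cdiff (stalk N) n (stalk_fun n x).
Proof. by rewrite /= /stalk_diff raddf0. Qed.

Definition stalk_map : chain_map (stalk M) (stalk N) := ChainMap stalk_funP.

End StalkMap.

Section Cone.
Variables (X Y : complex) (f : chain_map X Y).

Definition cone_obj (n : int) : lmodType R := (X (n + 1)%R * Y n)%type.

Definition cone_diff (n : int) (u : cone_obj n) : cone_obj (n + 1) :=
  (- cdiff X (n + 1) u.1, f (n + 1) u.1 + cdiff Y n u.2).

Lemma cone_diff_is_linear n : linear (@cone_diff n).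
Proof.
move=> a [x y] [x' y']; congr pair; rewrite /=.
  by rewrite (linearP (cdiff X _)) opprD scalerN.
by rewrite (linearP (f _)) (linearP (cdiff Y _)) scalerDr addrACA.
Qed.
HB.instance Definition _ n := GRing.isLinear.Build R (cone_obj n)
  (cone_obj (n + 1)) _ (@cone_diff n) (@cone_diff_is_linear n).

Lemma cone_diffK n (u : cone_obj n) : cone_diff (cone_diff u) = 0.
Proof.
congr pair; rewrite /= raddfN ?raddfD /= !cdiffK ?oppr0 // addr0 cmapP.
exact: addNr.
Qed.

Definition cone : complex := @Complex cone_obj (fun n => @cone_diff n) cone_diffK.

End Cone.

Section Homology.
Variable C : complex.

Section Degree.
Variable n : int.

Definition is_cycle : pred (C n) := fun x => cdiff C n x == 0.

Lemma is_cycle_submod : submod_closed is_cycle.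
Proof.
split=> [|a x y /eqP dx /eqP dy]; apply/eqP; first exact: raddf0.
by rewrite linearP dx dy scaler0 addr0.
Qed.
HB.instance Definition _ :=
  GRing.isSubmodClosed.Build R (C n) is_cycle is_cycle_submod.

Record cycle := Cycle { cycle_val : C n; cycleP : cycle_val \in is_cycle }.

HB.instance Definition _ := [isSub for cycle_val].
HB.instance Definition _ := [Choice of cycle by <:].
HB.instance Definition _ := [SubChoice_isSubLmodule of cycle by <:].

End Degree.

Inductive is_boundary : forall n, C n -> Prop :=
| IsBoundary n (x : C n) : is_boundary (cdiff C n x).

Definition homology (n : int) : lmodType R :=
  quot [set z : cycle n | is_boundary (val z)].

End Homology.

Section HomologyMap.
Variables (C D : complex) (f : chain_map C D) (n : int).

Lemma cycle_map_subproof (z : cycle C n) : f n (val z) \in @is_cycle D n.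
Proof. by apply/eqP; rewrite -cmapP (eqP (cycleP z)) raddf0. Qed.

Definition cycle_map (z : cycle C n) : cycle D n := Cycle (cycle_map_subproof z).

Lemma cycle_map_is_linear : linear cycle_map.
Proof. by move=> a x y; apply: val_inj; rewrite /= linearP. Qed.
HB.instance Definition _ := GRing.isLinear.Build R (cycle C n) (cycle D n) _
  cycle_map cycle_map_is_linear.

Lemma is_boundary_map m (x : C m) : is_boundary x -> is_boundary (f m x).
Proof. by case=> k y; rewrite cmapP; constructor. Qed.

Definition cycle_class : {linear cycle C n -> homology D n} :=
  qpi [set z : cycle D n | is_boundary (val z)] \o cycle_map.

Lemma cycle_class_boundary (z : cycle C n) :
  [set z : cycle C n | is_boundary (val z)] z -> cycle_class z = 0.
Proof. by move=> bz; apply/qpi_eq0; apply: sub_span; apply: is_boundary_map. Qed.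

Definition homology_map : {linear homology C n -> homology D n} :=
  quot_lift cycle_class_boundary.

End HomologyMap.

Definition quasi_iso (C D : complex) (f : chain_map C D) : Prop :=
  forall n, bijective (homology_map f n).

End Complexes.

(* The tensor product of complexes, with
   d(x (x) y) = dx (x) y + (-1)^p x (x) dy for [x] of degree [p]. *)
Section TensorComplex.
Variables (R : comPzRingType) (X Y : complex R).

Record bideg (n : int) := Bideg {
  bideg_val : int * int;
  bidegP : bideg_val.1 + bideg_val.2 == n
}.
HB.instance Definition _ n := [isSub for @bideg_val n].
HB.instance Definition _ n := [Choice of bideg n by <:].
Definition fdeg n (i : bideg n) : int := (bideg_val i).1.
Definition sdeg n (i : bideg n) : int := (bideg_val i).2.

Definition bideg_obj n (i : bideg n) : lmodType R :=
  tensor (X (fdeg i)) (Y (sdeg i)).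

Definition tcomplex_obj (n : int) : lmodType R := dsum (@bideg_obj n).

Lemma bideg_sl n (i : bideg n) : fdeg i + 1 + sdeg i == n + 1.
Proof. by rewrite addrAC (eqP (bidegP i)). Qed.

Lemma bideg_sr n (i : bideg n) : fdeg i + (sdeg i + 1) == n + 1.
Proof. by rewrite addrA (eqP (bidegP i)). Qed.

Definition bsl n (i : bideg n) : bideg (n + 1) :=
  @Bideg (n + 1) (fdeg i + 1, sdeg i) (bideg_sl i).
Definition bsr n (i : bideg n) : bideg (n + 1) :=
  @Bideg (n + 1) (fdeg i, sdeg i + 1) (bideg_sr i).

Definition tdiff_summand n (i : bideg n) :
    {linear bideg_obj i -> tcomplex_obj (n + 1)} :=
  (inj (bsl i) \o tensor_map (cdiff X (fdeg i)) idfun)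
  \+ ((-1) ^+ absz (fdeg i)
       \*: (inj (bsr i) \o tensor_map idfun (cdiff Y (sdeg i)))).

Definition tdiff (n : int) : tcomplex_obj n -> tcomplex_obj (n + 1) :=
  dsum_lift (@tdiff_summand n).
HB.instance Definition _ n :=
  GRing.Linear.copy (@tdiff n) (dsum_lift (@tdiff_summand n)).

Lemma tdiffE n (i : bideg n) x y :
  tdiff (inj i (tmul x y)) =
    inj (bsl i) (tmul (cdiff X _ x) y)
    + (-1) ^+ absz (fdeg i) *: inj (bsr i) (tmul x (cdiff Y _ y)).
Proof. by rewrite /tdiff dsum_lift_inj /= !tensor_mapE. Qed.

Lemma inj_irr n (p q : int) (e e' : p + q == n) (v : tensor (X p) (Y q)) :
  inj (@Bideg n (p, q) e) v = inj (@Bideg n (p, q) e') v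
    :> tcomplex_obj n.
Proof. by rewrite (eq_irrelevance e e'). Qed.

Lemma sign_succ (p : int) : (-1) ^+ absz (p + 1) = - (-1) ^+ absz p :> R.
Proof.
case: p => [k|[|k]] /=; first by rewrite addn1 exprS mulN1r.
  by rewrite expr1 opprK.
by rewrite subn1 /= !exprS !mulN1r opprK.
Qed.

Lemma tdiffK n (u : tcomplex_obj n) : tdiff (tdiff u) = 0.
Proof.
apply: (dsum_ind_ext (f := @tdiff _ \o @tdiff n : {linear _ -> _})
  (g := \0)) => i v.
apply: (tensor_ext (f := (@tdiff _ \o @tdiff n) \o inj i : {linear _ -> _})
  (g := \0)) => x y /=.
rewrite tdiffE raddfD /= linearZ_LR /= !tdiffE.
have -> : cdiff X (fdeg (bsl i)) (cdiff X (fdeg i) x) = 0 := cdiffK x.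
have -> : cdiff Y (sdeg (bsr i)) (cdiff Y (sdeg i) y) = 0 := cdiffK y.
rewrite tmul0l tmul0r !(raddf0 (inj _)) add0r scaler0 addr0.
rewrite {1}/fdeg /= -/(fdeg i) sign_succ scaleNr.
apply/eqP; rewrite addr_eq0 eqr_opp; apply/eqP; congr (_ *: _); exact: inj_irr.
Qed.

Definition tensor_complex : complex R :=
  @Complex R tcomplex_obj (fun n => @tdiff n) tdiffK.

End TensorComplex.

(* [C (x) M], for a module [M]. *)
Section BaseChange.
Variables (R : comPzRingType) (C : complex R).

Section Obj.
Variable M : lmodType R.

Definition cotimes_diff (n : int) : {linear tensor (C n) M -> tensor (C (n + 1)) M} :=
  tensor_map (cdiff C n) idfun.

Lemma cotimes_diffK n u : cotimes_diff (n + 1) (cotimes_diff n u) = 0.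
Proof.
apply: (tensor_ext (f := cotimes_diff (n + 1) \o cotimes_diff n : {linear _ -> _})
  (g := \0)) => x y /=.
by rewrite !tensor_mapE cdiffK tmul0l.
Qed.

Definition cotimes : complex R := Complex cotimes_diffK.

End Obj.

(* An [R]-linear map [f : R -> M] induces [C = C (x) R -> C (x) M]. *)
Section Map.
Variables (M : lmodType R) (f : {linear R^o -> M}).

Definition cotimes_fun (n : int) (x : C n) : cotimes M n :=
  tensor_map idfun f (tmul x (1 : R^o)).

Lemma cotimes_fun_is_linear n : linear (@cotimes_fun n).
Proof. by move=> a x y; rewrite /cotimes_fun !tensor_mapE tmulDl tmulZl. Qed.
HB.instance Definition _ n := GRing.isLinear.Build R (C n) (cotimes M n) _
  (@cotimes_fun n) (@cotimes_fun_is_linear n).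

Lemma cotimes_funP n x :
  cotimes_fun (cdiff C n x) = cdiff (cotimes M) n (cotimes_fun x).
Proof. by rewrite /cotimes_fun /= /cotimes_diff /= !tensor_mapE. Qed.

Definition cotimes_map : chain_map C (cotimes M) :=
  @ChainMap R C (cotimes M) (fun n => @cotimes_fun n) cotimes_funP.

End Map.

End BaseChange.

Section Koszul.
Variable R : comPzRingType.

Definition kos1 (s : R) : complex R :=
  cone (stalk_map (s \*: idfun : {linear R^o -> R^o})).

Definition kos (s : seq R) : complex R :=
  foldr (fun a K => tensor_complex (kos1 a) K) (stalk (R^o : lmodType R)) s.

End Koszul.

(* Ideals of [R] are the submodules of [R^o]. *)
Section Ideals.
Variable R : comPzRingType.

Definition ideal_gen (s : seq R) : set R^o := span [set a : R^o | a \in s].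

Definition noetherian : Prop :=
  forall J : set R^o, submodule J -> exists t : seq R, J = ideal_gen t.

Definition ideal_mul (I J : set R^o) : set R^o :=
  span [set z : R^o | exists a b : R, [/\ I a, J b & z = a * b]].

Definition ideal_pow (I : set R^o) (n : nat) : set R^o :=
  iter n (ideal_mul I) setT.

Lemma submodule_mull (J : set R^o) (a b : R) : submodule J -> J b -> J (a * b).
Proof. by case=> J0 JL Jb; have := JL a b 0 Jb J0; rewrite addr0. Qed.

Lemma ideal_pow_submodule I n : submodule (ideal_pow I n).
Proof. by case: n => [|n]; [split | exact: span_submodule]. Qed.

Lemma ideal_powS I n : ideal_pow I n.+1 `<=` ideal_pow I n.
Proof.
apply: span_min; first exact: ideal_pow_submodule.
move=> _ [a [b [_ Jb ->]]].
by apply: submodule_mull => //; exact: ideal_pow_submodule.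
Qed.

End Ideals.

(* [lim_n R/I^n] as the [R]-module of compatible families; only its module
   structure enters in [kos (x) lim_n R/I^n]. *)
Section Completion.
Variables (R : comPzRingType) (I : set R^o).

Definition quot_pow (n : nat) : lmodType R := quot (ideal_pow I n).

Lemma transition_subproof n x :
  ideal_pow I n.+1 x -> qpi (ideal_pow I n) x = 0.
Proof. by move=> Ix; apply/qpi_eq0; apply: sub_span; apply: ideal_powS. Qed.

Definition transition n : {linear quot_pow n.+1 -> quot_pow n} :=
  quot_lift (transition_subproof (n := n)).

Definition compatible : pred (dprod quot_pow) :=
  fun x => `[< forall n, transition n (x n.+1) = x n >].

Lemma compatible_submod : submod_closed compatible.
Proof.
split=> [|a x y /asboolP cx /asboolP cy]; apply/asboolP => n.
  exact: raddf0.
by rewrite !dprodDE !dprodZE linearP cx cy.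
Qed.
HB.instance Definition _ := GRing.isSubmodClosed.Build R (dprod quot_pow)
  compatible compatible_submod.

Record completion := Completion {
  completion_val : dprod quot_pow;
  completionP : completion_val \in compatible
}.

HB.instance Definition _ := [isSub for completion_val].
HB.instance Definition _ := [Choice of completion by <:].
HB.instance Definition _ := [SubChoice_isSubLmodule of completion by <:].

Lemma to_completion_subproof (x : R) :
  (fun n => qpi (ideal_pow I n) x) \in compatible.
Proof. by apply/asboolP => n; exact: quot_liftE. Qed.

Definition to_completion (x : R^o) : completion :=
  Completion (to_completion_subproof x).

Lemma to_completion_is_linear : linear to_completion.
Proof.
move=> a x y; apply: val_inj; apply: dprodP => n /=.
by rewrite linearP.
Qed.
HB.instance Definition _ := GRing.isLinear.Build R R^o completion _
  to_completion to_completion_is_linear.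

End Completion.

Definition koszul_complete (R : comPzRingType) (s : seq R) : Prop :=
  quasi_iso (cotimes_map (kos s) (to_completion (ideal_gen s))).

(* Main.v *)
(* The complex [kos s] consists of finitely generated projective modules, and a
   power of each member of [s] kills its homology, by induction on [s]: tensoring
   with [kos1 a] is taking the cone of multiplication by [a].  A weak form of the
   Artin-Rees lemma then shows that a cycle which is [I]-adically deep is the
   boundary of a deep chain.  Injectivity on homology follows by truncating a
   bounding chain of the completed complex.  For surjectivity, a completed cycle
   is the limit of honest cycles [z_l] with [z_(l+1) - z_l = d y_l] and [y_l]
   tending to [0], hence it is [z_0 + d (\sum_l y_l)]. *)

From HB Require Import structures.
From mathcomp Require Import all_boot all_algebra.
From mathcomp Require Import boolp classical_sets.
Require Import Defs.

Set Implicit Arguments.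
Unset Strict Implicit.
Unset Printing Implicit Defensive.

Import GRing.Theory.

Local Open Scope classical_set_scope.
Local Open Scope ring_scope.

(** * Submodules and the ascending chain condition *)

Section Submodule.
Variables (R : pzRingType) (M : lmodType R).
Implicit Types (N E : set M) (a : R) (x y : M).

Lemma submodule0 N : submodule N -> N 0.
Proof. by case. Qed.

Lemma submoduleD N x y : submodule N -> N x -> N y -> N (x + y).
Proof. by move=> [_ NL] Nx Ny; rewrite -[x]scale1r; apply: NL. Qed.

Lemma submoduleZ N a x : submodule N -> N x -> N (a *: x).
Proof. by move=> [N0 NL] Nx; rewrite -[_ *: _]addr0; apply: NL. Qed.

Lemma submoduleB N x y : submodule N -> N x -> N y -> N (x - y).
Proof.
move=> sN Nx Ny; apply: submoduleD => //.
by rewrite -scaleN1r; apply: submoduleZ.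
Qed.

Lemma submodule_sum (B : Type) (r : seq B) (F : B -> M) N :
  submodule N -> (forall b, N (F b)) -> N (\sum_(b <- r) F b).
Proof.
move=> sN NF; apply: (big_ind N) => //; first exact: submodule0.
by move=> x y; apply: submoduleD.
Qed.

Lemma span_id N : submodule N -> span N = N.
Proof.
by move=> sN; rewrite eqEsubset; split; [apply: span_min | exact: sub_span].
Qed.

Definition acc : Prop := forall C : nat -> set M,
  (forall n, submodule (C n)) -> (forall n, C n `<=` C n.+1) ->
  exists n, forall m, C m `<=` C n.

Lemma chain_le (T : Type) (C : nat -> set T) m n :
  (forall n, C n `<=` C n.+1) -> (m <= n)%N -> C m `<=` C n.
Proof.
move=> CS /subnK <-; elim: (n - m)%N => // k IH.
exact: subset_trans IH (CS _).
Qed.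

End Submodule.

Arguments acc {R} M.

Section Acc.
Variable R : pzRingType.
Implicit Types M N : lmodType R.

Lemma acc_surj M N (f : {linear M -> N}) :
  (forall y, exists x, f x = y) -> acc M -> acc N.
Proof.
move=> fsurj aM C sC CS.
have [||n nP] := aM (fun n => f @^-1` C n).
- move=> n; split=> [|a x y Cx Cy]; rewrite /preimage/= ?raddf0.
    exact: submodule0.
  by rewrite linearP; case: (sC n) => _; apply.
- by move=> n x; apply: CS.
exists n => m y; have [x <-] := fsurj y; exact: nP.
Qed.

(** A chain in the product is governed by its traces on [M] and its projections to [N]: once both
    are stationary, so is the chain. *)
Lemma acc_prod M N : acc M -> acc N -> acc (M * N)%type.
Proof.
move=> aM aN C sC CS.
have [||n1 n1P] := aM (fun n => [set x | C n (x, 0)]).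
- move=> n; split=> [|a x y Cx Cy] /=; first exact: (submodule0 (sC n)).
  have := (sC n).2 a _ _ Cx Cy.
  by rewrite [X in C n X](_ : _ = (a *: x + y, a *: 0 + 0)) // scaler0 addr0.
- by move=> n x; apply: CS.
have [||n2 n2P] := aN (fun n => [set y | exists x, C n (x, y)]).
- move=> n; split=> [|a x y [x' Cx] [y' Cy]] /=.
    by exists 0; exact: (submodule0 (sC n)).
  by exists (a *: x' + y'); have := (sC n).2 a _ _ Cx Cy.
- by move=> n x [y /CS Cy]; exists y.
exists (maxn n1 n2) => m [x y] Cxy.
have [x' Cx'] : exists x', C n2 (x', y) by apply: (n2P m); exists x.
have C1 : C (maxn n1 n2) (x', y) by exact: (chain_le CS (leq_maxr n1 n2) Cx').
(* Both [(x, y)] and [(x', y)] lie in a common late term; their difference lies in [M], where the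
   chain stops growing at [n1]. *)
have C2 : C (maxn n1 n2) (x - x', 0).
  apply: (chain_le CS (leq_maxl n1 n2)); apply: (n1P (maxn m (maxn n1 n2))).
  rewrite /= [X in C _ X](_ : _ = (x, y) - (x', y)); last first.
    by congr pair; rewrite /= subrr.
  apply: submoduleB; first exact: sC.
    exact: (chain_le CS (leq_maxl _ _) Cxy).
  exact: (chain_le CS (leq_maxr _ _) C1).
have := submoduleD (sC _) C1 C2.
rewrite [X in C _ X](_ : _ = (x, y)) //.
by congr pair; rewrite /= ?addr0 // subrKC.
Qed.

End Acc.

Lemma acc_trivial (R : pzRingType) (M : lmodType R) :
  (forall x : M, x = 0) -> acc M.
Proof.
by move=> M0 C sC _; exists 0%N => m x _; rewrite (M0 x); apply: submodule0.
Qed.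

(** * Noetherian rings and powers of ideals *)

Section Ideals.
Variable R : comPzRingType.
Implicit Types (I J : set R^o) (s : seq R).

(** The union of a chain is an ideal, and its finitely many generators all lie in one term. *)
Lemma noetherian_acc : noetherian R -> acc (R^o : lmodType R).
Proof.
move=> hR C sC CS; pose J : set R^o := [set x | exists n, C n x].
have sJ : submodule J.
  split=> [|a x y [n Cx] [m Cy]]; first by exists 0%N; apply: submodule0.
  exists (maxn n m); apply: (sC _).2.
    exact: (chain_le CS (leq_maxl n m) Cx).
  exact: (chain_le CS (leq_maxr n m) Cy).
have [t Jt] := hR J sJ.
have [n nP] : exists n, forall x, x \in t -> C n x.
  have : forall x, x \in t -> J x by move=> x xt; rewrite Jt; apply: sub_span.
  elim: t {Jt} => [|x t IH] tJ; first by exists 0%N.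
  have [|n nP] := IH; first by move=> y yt; apply: tJ; rewrite inE yt orbT.
  have [m Cm] := tJ x (mem_head _ _).
  exists (maxn n m) => y; rewrite inE => /orP[/eqP ->|/nP Cy].
    exact: (chain_le CS (leq_maxr n m) Cm).
  exact: (chain_le CS (leq_maxl n m) Cy).
exists n => m x Cx; have : J x by exists m.
by rewrite Jt; apply: span_min.
Qed.

Lemma ideal_powW I m n : (m <= n)%N -> ideal_pow I n `<=` ideal_pow I m.
Proof.
move=> /subnK <-; elim: (n - m)%N => // k IH.
exact: subset_trans (@ideal_powS _ _ _) IH.
Qed.

Lemma ideal_pow_expr I (a : R) n : I a -> ideal_pow I n (a ^+ n).
Proof.
move=> Ia; elim: n => // n IH; rewrite exprS.
by apply: sub_span; exists a, (a ^+ n).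
Qed.

(** For fixed [b] the elements [a] with [a * b] in [J] form an ideal, so it suffices to test the
    members of [s]. *)
Lemma ideal_powS_sub s J n : submodule J ->
  (forall x b, x \in s -> ideal_pow (ideal_gen s) n b -> J (x * b)) ->
  ideal_pow (ideal_gen s) n.+1 `<=` J.
Proof.
move=> sJ sIJ; apply: span_min => // _ [a [b [Ia Ib ->]]].
have sA : submodule [set a : R^o | J (a * b)].
  split=> [|c x y Ax Ay] /=; first by rewrite mul0r; apply: submodule0.
  by rewrite mulrDl -mulrA; apply: sJ.2.
by apply: (span_min sA _ Ia) => x /= xs; apply: sIJ.
Qed.

(* Induction on the sum of the exponents, passing from [J] to the colon ideals
   [(J : x)] for [x] in [s]. *)
Lemma ideal_pow_sub_exponents s J (k : R -> nat) N : submodule J ->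
  (forall x, x \in s -> J (x ^+ k x)) -> (\sum_(x <- s) k x <= N)%N ->
  ideal_pow (ideal_gen s) N.+1 `<=` J.
Proof.
elim: N k J => [|N IH] k J sJ Jk kN.
all: apply: ideal_powS_sub => // x b xs Ib.
all: have k0 : k x = 0%N -> J (x * b) by
  by move=> kx; rewrite -[x * b]mulr1; apply: submodule_mull => //;
  have := Jk x xs; rewrite kx.
  apply: k0; apply/eqP; rewrite -leqn0; apply: leq_trans kN.
  by rewrite (big_rem x) //= leq_addr.
have [/k0 //|kx] := posnP (k x).
(* The ideal [(J : x)] contains [x ^+ (k x).-1] and still the old powers of the other members of
   [s]. As [x] may recur in [s], the sum of the exponents drops by at least one. *)
pose k' y := if y == x then (k x).-1 else k y.
apply: (IH k' [set b | J (x * b)]) Ib.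
- split=> [|c u v Ju Jv]; rewrite /= ?mulr0; first exact: (submodule0 sJ).
  by rewrite mulrDr mulrCA; apply: sJ.2.
- move=> y ys; rewrite /= /k'; case: eqP => [->|_].
    by rewrite -exprS prednK //; apply: Jk.
  by apply: submodule_mull => //; apply: Jk.
- rewrite -ltnS; apply: leq_trans kN.
  rewrite [X in (_ < X)%N](big_rem x) //= (big_rem x) //= {1}/k' eqxx.
  rewrite -addSn prednK // leq_add2l; apply: leq_sum => y _.
  by rewrite /k'; case: eqP => [->|//]; exact: leq_pred.
Qed.

Lemma ideal_pow_sub s J : submodule J ->
  (forall x, x \in s -> exists k, J (x ^+ k)) ->
  exists m, ideal_pow (ideal_gen s) m `<=` J.
Proof.
move=> sJ Js.
have /choice[k kP] : forall x, exists k, x \in s -> J (x ^+ k).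
  move=> x; have [/Js[k]|/negP] := boolP (x \in s); first by exists k.
  by exists 0%N.
exists (\sum_(x <- s) k x).+1; exact: (ideal_pow_sub_exponents sJ kP).
Qed.

End Ideals.

(** * Finitely generated projective modules *)

Section ProjectiveModules.
Variable R : comPzRingType.
Implicit Types M N : lmodType R.
Local Notation vec_form M := (M * {linear M -> R^o})%type.

(* This is the dual basis criterion. *)
Definition fg_projective M : Prop :=
  exists B : seq (vec_form M),
    forall x, x = \sum_(b <- B) b.2 x *: b.1.

Lemma fg_projective_trivial M : (forall x : M, x = 0) -> fg_projective M.
Proof. by move=> M0; exists [::] => x; rewrite big_nil. Qed.

Lemma fg_projective_regular : fg_projective (R^o : lmodType R).
Proof.
exists [:: ((1 : R^o), (idfun : {linear R^o -> R^o}))] => x.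
by rewrite big_seq1 /= /GRing.scale /= mulr1.
Qed.

Lemma fg_projective_retract M N (f : {linear M -> N}) (g : {linear N -> M}) :
  cancel g f -> fg_projective M -> fg_projective N.
Proof.
move=> gK [B BP].
exists [seq (f b.1, (b.2 \o g : {linear N -> R^o})) | b : vec_form M <- B] => x.
rewrite big_map -{1}[x]gK {1}[g x]BP linear_sum.
by apply: eq_bigr => b _; rewrite linearZ.
Qed.

Lemma fg_projective_prod M N :
  fg_projective M -> fg_projective N -> fg_projective (M * N)%type.
Proof.
move=> [B BP] [C CP].
exists ([seq ((b.1, 0), (b.2 \o fst : {linear (M * N)%type -> R^o}))
             | b : vec_form M <- B]
  ++ [seq ((0, c.1), (c.2 \o snd : {linear (M * N)%type -> R^o}))
        | c : vec_form N <- C]) => -[x y].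
rewrite big_cat !big_map /=.
rewrite {1}[x]BP {1}[y]CP.
have fE (r : seq (vec_form M)) :
    \sum_(b <- r) b.2 x *: ((b.1, 0) : (M * N)%type) =
    (\sum_(b <- r) b.2 x *: b.1, 0).
  elim: r => [|b r IH]; rewrite ?big_nil // !big_cons IH.
  by congr pair; rewrite /= ?scaler0 ?addr0.
have gE (r : seq (vec_form N)) :
    \sum_(b <- r) b.2 y *: ((0, b.1) : (M * N)%type) =
    (0, \sum_(b <- r) b.2 y *: b.1).
  elim: r => [|b r IH]; rewrite ?big_nil // !big_cons IH.
  by congr pair; rewrite /= ?scaler0 ?addr0.
by rewrite fE gE; congr pair; rewrite /= ?addr0 ?add0r.
Qed.

End ProjectiveModules.

(** * Contraction of tensors against linear forms *)

Section Contraction.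
Variables (R : comPzRingType) (M N : lmodType R) (f : {linear M -> R^o}).

Definition contr_free (u : free R (M * N)%type) : N :=
  dsum_lift (fun p : M * N => coeff ((f p.1 : R) *: p.2) : {linear R^o -> N}) u.
HB.instance Definition _ := GRing.Linear.copy contr_free
  (dsum_lift (fun p : M * N => coeff ((f p.1 : R) *: p.2) : {linear R^o -> N})).

Lemma contr_gen x y : contr_free (gen (x, y)) = (f x : R) *: y.
Proof. by rewrite /contr_free dsum_lift_inj /= /coeff scale1r. Qed.

Lemma contr_rel u : bilin_rel u -> contr_free u = 0.
Proof.
case=> [x x' y|x y y'|a x y|a x y]; apply/eqP;
  rewrite raddfB subr_eq0 /= ?raddfD /=; apply/eqP.
- by rewrite !contr_gen raddfD scalerDl.
- by rewrite !contr_gen scalerDr.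
- rewrite contr_gen linearZ_LR.
  apply: etrans (esym (linearZ_LR contr_free _ _)).
  by rewrite /= contr_gen scalerA.
- rewrite contr_gen; apply: etrans (esym (linearZ_LR contr_free _ _)).
  by rewrite /= contr_gen !scalerA mulrC.
Qed.

(** This is [f (x) N] followed by [R (x) N = N]. Contractions with the forms of a dual basis of [M]
    serve as coordinates of a tensor. *)
Definition contr : tensor M N -> N := quot_lift contr_rel.
HB.instance Definition _ := GRing.Linear.copy contr (quot_lift contr_rel).

Lemma contrE x y : contr (tmul x y) = (f x : R) *: y.
Proof. by rewrite /contr quot_liftE; apply: contr_gen. Qed.

End Contraction.

Section TensorFacts.
Variables (R : comPzRingType).
Implicit Types M N P : lmodType R.

Lemma contr_map M M' N (f : {linear M' -> R^o}) (g : {linear M -> M'}) u :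
  contr f (tensor_map g (idfun : {linear N -> N}) u) = contr (f \o g) u.
Proof.
apply: (tensor_ext (f := contr f \o tensor_map g (idfun : {linear N -> N})
    : {linear _ -> _}) (g := contr (f \o g) : {linear _ -> _})) => x y /=.
by rewrite tensor_mapE !contrE.
Qed.

(** Both sides are linear in [u]; on a pure tensor, expand the left factor and move the scalars
    across the tensor sign. *)
Lemma tensor_dual_basis M N (B : seq (M * {linear M -> R^o})) :
  (forall x, x = \sum_(b <- B) b.2 x *: b.1) ->
  forall u : tensor M N, u = \sum_(b <- B) tmul b.1 (contr b.2 u).
Proof.
move=> BP.
have sL : linear (fun u : tensor M N => \sum_(b <- B) tmul b.1 (contr b.2 u)).
  move=> a u v; rewrite scaler_sumr -big_split; apply: eq_bigr => b _ /=.
  by rewrite linearP tmulDr tmulZr.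
pose s := GRing.isLinear.Build R _ _ _ _ sL.
pose sl : {linear tensor M N -> tensor M N} := HB.pack
  (fun u : tensor M N => \sum_(b <- B) tmul b.1 (contr b.2 u)) s.
move=> u; apply: (tensor_ext (f := idfun : {linear tensor M N -> _})
  (g := sl)) => x y /=.
have tl : {morph (fun x : M => tmul x y) : a b / a + b}.
  by move=> a b; apply: tmulDl.
rewrite {1}[x]BP (big_morph _ tl (tmul0l _ y)).
by apply: eq_bigr => b _; rewrite contrE tmulZl tmulZr.
Qed.

End TensorFacts.

(** * The [I]-adic filtration of a module *)

Section Deep.
Variables (R : comPzRingType) (I : set R^o).
Implicit Types M N : lmodType R.

(* For projective [M] this is the submodule [I^m M]. *)
Definition deep M (m : nat) : set M :=
  [set x | forall f : {linear M -> R^o}, ideal_pow I m (f x)].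

Lemma deep_submodule M m : submodule (@deep M m).
Proof.
split=> [|a x y dx dy] f.
  by rewrite raddf0; case: (ideal_pow_submodule I m).
by rewrite linearP; apply: (ideal_pow_submodule I m).2.
Qed.

Lemma deepW M m n : (m <= n)%N -> @deep M n `<=` @deep M m.
Proof. by move=> mn x dx f; apply: (ideal_powW mn). Qed.

Lemma deepX M (a : R) m (x : M) : I a -> deep m (a ^+ m *: x).
Proof.
move=> Ia f; rewrite linearZ /= /GRing.scale /= mulrC.
apply: submodule_mull; first exact: ideal_pow_submodule.
exact: ideal_pow_expr.
Qed.

Lemma submodule_image M N (f : {linear M -> N}) (P : set M) :
  submodule P -> submodule (f @` P).
Proof.
move=> sP; split=> [|a _ _ [x Px <-] [y Py <-]].
  by exists 0; [exact: submodule0 | exact: raddf0].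
by exists (a *: x + y); [exact: sP.2 | rewrite linearP].
Qed.

End Deep.

(** * A weak form of the Artin-Rees lemma *)

Section ArtinRees.
Variables (R : comPzRingType) (s : seq R) (M : lmodType R).
Implicit Types N P E : set M.
Let I := ideal_gen s.

(* Enlarging [E] by [x ^+ j M] does not change its trace on [N] as soon as the
   chain of the colon modules [(E : x ^+ j)] is stationary at [j]. *)
Lemma acc_enlarge (t : seq R) P N : acc M -> submodule P -> submodule N ->
  (forall x, x \in t -> exists k, forall z, N z -> P (x ^+ k *: z)) ->
  exists E, [/\ submodule E, P `<=` E, N `&` E `<=` P &
    forall x, x \in t -> exists k, forall z, E (x ^+ k *: z)].
Proof.
move=> aM sP sN; elim: t => [|x t IH] tP; first by exists P; split=> // z [].
have [|E [sE PE NE tE]] := IH.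
  by move=> y yt; apply: tP; rewrite inE yt orbT.
have [k kP] := tP x (mem_head _ _).
have [||j jP] := aM (fun j => [set z | E (x ^+ j *: z)]).
- move=> j; split=> [|a y z Ey Ez] /=.
    by rewrite scaler0; apply: submodule0.
  by rewrite scalerDr scalerA [x ^+ j * a]mulrC -scalerA; apply: sE.2.
- by move=> j z /= Ez; rewrite exprS -scalerA; apply: submoduleZ.
exists [set z | exists e f, E e /\ z = e + x ^+ j *: f]; split.
- split=> [|a _ _ [e [f [Ee ->]]] [e' [f' [Ee' ->]]]] /=.
    by exists 0, 0; rewrite scaler0 addr0; split=> //; apply: submodule0.
  exists (a *: e + e'), (a *: f + f'); split; first exact: sE.2.
  by rewrite !scalerDr !scalerA [x ^+ j * a]mulrC addrACA.
- by move=> z /PE Ez; exists z, 0; rewrite scaler0 addr0.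
- move=> z [Nz [e [f [Ee ze]]]]; apply: NE; split=> //.
  (* Since [x ^+ k *: z] lies in [P], hence in [E], so does [x ^+ (k + j) *: f = x ^+ k *: (z - e)];
     by stationarity already [x ^+ j *: f] lies in [E]. *)
  rewrite ze; apply: submoduleD => //; apply: (jP (k + j)%N).
  rewrite /= exprD -scalerA (_ : x ^+ j *: f = z - e).
    2: by rewrite ze addrC addKr.
  by rewrite scalerBr; apply: submoduleB => //;
    [apply/PE/kP | apply: submoduleZ].
- move=> y; rewrite inE => /orP[/eqP ->|/tE[l lP]].
    by exists j => z; exists 0, z; rewrite add0r; split=> //; apply: submodule0.
  exists l => z; exists (y ^+ l *: z), 0.
  by rewrite scaler0 addr0; split=> //; apply: lP.
Qed.

(** The scalars that map all of [M] into [P] form an ideal containing a power of each member of [s],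
    hence some [I^m]; a deep element has its dual basis coefficients in [I^m]. *)
Lemma deep_sub P : fg_projective M -> submodule P ->
  (forall x, x \in s -> exists k, forall z, P (x ^+ k *: z)) ->
  exists m, deep I m `<=` P.
Proof.
move=> [B BP] sP Ps.
have [||m mP] := @ideal_pow_sub _ s [set a : R^o | forall z, P ((a : R) *: z)].
- split=> [|a x y Px Py] z /=; first by rewrite scale0r; apply: submodule0.
  by rewrite scalerDl -scalerA; apply: sP.2.
- by move=> x /Ps[k kP]; exists k => z; apply: kP.
exists m => z dz; rewrite [z]BP; apply: submodule_sum => // b.
by apply: mP; apply: dz.
Qed.

(** Some [E] has its trace on [N] inside [P], while a power of each member of [s] kills [M / E]. The
    latter forces [E] to contain all elements of some depth. *)
Lemma weak_artin_rees P N : acc M -> fg_projective M ->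
  submodule P -> submodule N ->
  (forall x, x \in s -> exists k, forall z, N z -> P (x ^+ k *: z)) ->
  exists m, N `&` deep I m `<=` P.
Proof.
move=> aM fM sP sN sNP.
have [E [sE _ NE sE']] := acc_enlarge aM sP sN sNP.
have [m mP] := deep_sub fM sE sE'.
by exists m => z [Nz /mP Ez]; apply: NE.
Qed.

End ArtinRees.

(** * Approximating elements of [M (x) hat] by elements of [M] *)

Section Approximation.
Variables (R : comPzRingType) (I : set R^o).
Implicit Types M N : lmodType R.
Local Notation hat := (completion I).

(* The images of [u] and [x] in [M (x) R/I^m] agree; linear forms suffice to
   detect this when [M] is finitely generated projective. *)
Definition approx M (m : nat) (u : tensor M hat) (x : M) : Prop :=
  forall f : {linear M -> R^o},
    completion_val (contr f u) m = qpi (ideal_pow I m) (f x).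

Lemma completion_ext (a b : hat) :
  (forall m, completion_val a m = completion_val b m) -> a = b.
Proof. by move=> ab; apply: val_inj; apply: dprodP. Qed.

Lemma qpi_pow m (a b : R^o) :
  qpi (ideal_pow I m) a = qpi (ideal_pow I m) b <-> ideal_pow I m (a - b).
Proof. by rewrite qpi_eq (span_id (ideal_pow_submodule I m)). Qed.

Lemma completion_pred (a : hat) m (r : R^o) :
  completion_val a m.+1 = qpi (ideal_pow I m.+1) r ->
  completion_val a m = qpi (ideal_pow I m) r.
Proof.
by have /asboolP/(_ m) <- := completionP a; move=> ->; apply: quot_liftE.
Qed.

Lemma approxW M m n (u : tensor M hat) x : (m <= n)%N ->
  approx n u x -> approx m u x.
Proof.
move=> /subnK <-; elim: (n - m)%N => // k IH ux; apply: IH => f.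
by apply: completion_pred; apply: ux.
Qed.

Lemma approx_deep M m (u : tensor M hat) x y :
  approx m u x -> approx m u y -> deep I m (x - y).
Proof. by move=> ux uy f; rewrite raddfB; apply/qpi_pow; rewrite -ux -uy. Qed.

Lemma deep_approx M m (u : tensor M hat) x y :
  approx m u x -> deep I m (x - y) -> approx m u y.
Proof.
by move=> ux xy f; rewrite ux; apply/qpi_pow; rewrite -raddfB; apply: xy.
Qed.

Lemma approxP M m a (u v : tensor M hat) x y :
  approx m u x -> approx m v y -> approx m (a *: u + v) (a *: x + y).
Proof.
move=> ux vy f; rewrite !linearP /=.
by move: (ux f) (vy f) => <- <-.
Qed.

Lemma approxD M m (u v : tensor M hat) x y :
  approx m u x -> approx m v y -> approx m (u + v) (x + y).
Proof. by move=> ux vy; rewrite -[u]scale1r -[x]scale1r; apply: approxP. Qed.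

Lemma approx_map M N (g : {linear M -> N}) m u x :
  approx m u x -> approx m (tensor_map g idfun u) (g x).
Proof. by move=> ux f; rewrite contr_map; apply: ux. Qed.

Lemma approx_tmul M m (x : M) : approx m (tmul x (to_completion I (1 : R^o))) x.
Proof.
move=> f; rewrite contrE -[LHS]/((f x : R) *: qpi (ideal_pow I m) (1 : R^o)).
by rewrite -linearZ /= /GRing.scale /= mulr1.
Qed.

(** A tensor is recovered from its contractions with a dual basis, and these are elements of [hat],
    determined by their residues modulo all [I^m]. *)
Lemma approx_inj M (u v : tensor M hat) (z : nat -> M) : fg_projective M ->
  (forall m, approx m u (z m)) -> (forall m, approx m v (z m)) -> u = v.
Proof.
move=> [B BP] uz vz; rewrite (tensor_dual_basis BP u) (tensor_dual_basis BP v).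
apply: eq_bigr => b _; congr tmul; apply: completion_ext => m.
by rewrite uz vz.
Qed.

(** Lift to [R] the residues modulo [I^m] of the dual basis coordinates of [u]. *)
Lemma approx_exists M m (u : tensor M hat) :
  fg_projective M -> exists x, approx m u x.
Proof.
move=> [B BP].
exists (\sum_(b <- B) (repr (completion_val (contr b.2 u) m) : R) *: b.1) => f.
rewrite {1}(tensor_dual_basis BP u) !linear_sum.
have vD : {morph (fun a : hat => completion_val a m) : a b / a + b} by [].
rewrite (big_morph _ vD erefl); apply: eq_bigr => b _.
rewrite /= contrE linearZ /= linearZ /=.
rewrite -[LHS]/((f b.1 : R) *: completion_val (contr b.2 u) m).
move: (completion_val _ _) => w.
rewrite -{1}[w]reprK -[_ (repr w)]/(qpi (ideal_pow I m) (repr w)) -!linearZ /=.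
by congr qpi; rewrite !linearZ; exact: (mulrC (f b.1 : R)).
Qed.

(* The partial sums [\sum_(l < m) y l] form a Cauchy sequence for the
   [I]-adic topology. *)
Lemma approx_series M (y : nat -> M) : fg_projective M ->
  (forall l, deep I l (y l)) ->
  exists v : tensor M hat, forall m, approx m v (\sum_(l < m) y l).
Proof.
move=> [B BP] dy.
(* As [f (y m)] lies in [I^m], the values of [f] on the partial sums define an element of the
   completion. For [f] in a dual basis these are the coordinates of the limit. *)
have cP (f : {linear M -> R^o}) :
    (fun m => qpi (ideal_pow I m) (f (\sum_(l < m) y l)))
      \in compatible (I := I).
  apply/asboolP => m; rewrite [LHS]quot_liftE; apply/qpi_pow.
  by rewrite -raddfB big_ord_recr /= addrAC subrr add0r; apply: dy.
exists (\sum_(b <- B) tmul b.1 (Completion (cP b.2))) => m f.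
rewrite linear_sum.
have vD : {morph (fun a : hat => completion_val a m) : a b / a + b} by [].
rewrite (big_morph _ vD erefl) {1}[\sum_(l < m) y l]BP !linear_sum.
apply: eq_bigr => b _; rewrite /= contrE !linearZ /=.
rewrite -[LHS]/((f b.1 : R) *: qpi (ideal_pow I m) (b.2 (\sum_(l < m) y l))).
rewrite -!linearZ /=; congr qpi; rewrite !linearZ.
exact: (mulrC (f b.1 : R)).
Qed.

End Approximation.

Lemma bijective_inj_surj (A B : Type) (f : A -> B) :
  injective f -> (forall y, exists x, f x = y) -> bijective f.
Proof.
move=> fI /choice[g gK]; exists g => [x|//]; exact/fI/gK.
Qed.

(** * Quasi-isomorphisms in terms of cycles and boundaries *)

Section QuasiIso.
Variable R : pzRingType.
Implicit Types C D : complex R.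

(** The degree is an index of [is_boundary], so the inversion is done in a general degree [m] with a
    transport along [m = n + 1], which is trivial because proofs of equality in [int] are unique. *)
Lemma is_boundaryP C n (z : C (n + 1)) :
  is_boundary z <-> exists y, cdiff C n y = z.
Proof.
split=> [|[y <-]]; last exact: IsBoundary.
suff gen m (w : C m) : is_boundary w -> forall e : m = n + 1,
    exists y, cdiff C n y = ecast k (C k) e w.
  by move=> /gen /(_ erefl).
case=> k y e; have kn := addIr 1 e; subst k.
by exists y; rewrite eq_axiomK.
Qed.

(** Boundaries already form a submodule, so the span in the definition of homology adds nothing. *)
Lemma boundary_span C n (z : cycle C (n + 1)) :
  span [set z : cycle C (n + 1) | is_boundary (val z)] z <->
  exists y, cdiff C n y = val z.
Proof.
rewrite span_id; first exact: is_boundaryP.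
split=> [|a x y /is_boundaryP[x' x'E] /is_boundaryP[y' y'E]];
  apply/is_boundaryP.
  by exists 0; rewrite raddf0.
by exists (a *: x' + y'); rewrite linearP x'E y'E.
Qed.

(** Every degree has the form [n + 1]; written this way, the boundaries are the image of the
    differential from degree [n], without transport. *)
Lemma quasi_isoI C D (f : chain_map C D) :
  (forall n (z : C (n + 1)) u, cdiff C (n + 1) z = 0 ->
     cdiff D n u = f (n + 1) z -> exists y, cdiff C n y = z) ->
  (forall n (u : D (n + 1)), cdiff D (n + 1) u = 0 ->
     exists z v, cdiff C (n + 1) z = 0 /\ u = f (n + 1) z + cdiff D n v) ->
  quasi_iso f.
Proof.
move=> finj fsurj n; have := subrK 1 n; move: (n - 1) => k <- {n}.
have fE z : homology_map f (k + 1) (qpi _ z) = qpi _ (cycle_map f z).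
  exact: quot_liftE.
apply: bijective_inj_surj => [x y xy|].
  apply/eqP; rewrite -subr_eq0; apply/eqP.
  have {xy} : homology_map f (k + 1) (x - y) = 0.
    by rewrite raddfB; apply/eqP; rewrite subr_eq0; apply/eqP.
  elim/qpi_ind: (x - y) => z; rewrite fE => /qpi_eq0/boundary_span[u uz].
  apply/qpi_eq0/boundary_span.
  by apply: (finj k (val z) u) => //; apply/eqP/(cycleP z).
elim/qpi_ind => u; have [|z [v [dz uE]]] := fsurj k (val u).
  exact/eqP/(cycleP u).
have cz : z \in @is_cycle _ C (k + 1) by apply/eqP.
exists (qpi _ (Cycle cz)); rewrite fE; apply/qpi_eq/boundary_span.
by exists (- v); rewrite raddfN /= uE opprD addrA subrr add0r.
Qed.

End QuasiIso.

(** * Completion of a complex whose homology is killed by powers of [s] *)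

Section Completeness.
Variables (R : comPzRingType) (s : seq R) (C : complex R).
Let I := ideal_gen s.
Hypothesis accC : forall n, acc (C n).
Hypothesis projC : forall n, fg_projective (C n).

Definition homology_killed (x : R) : Prop :=
  forall n, exists k, forall z : C (n + 1),
    cdiff C (n + 1) z = 0 -> exists y, cdiff C n y = x ^+ k *: z.

Hypothesis killC : forall x, x \in s -> homology_killed x.

Lemma cycle_submodule n : submodule [set z : C n | cdiff C n z = 0].
Proof.
by split=> [|a x y /= dx dy]; rewrite /= ?raddf0 // linearP dx dy scaler0 addr0.
Qed.

(** Weak Artin-Rees applies to the cycles and the image of the depth [l] chains: from
    [x ^+ k *: z = d y] follows [x ^+ (l + k) *: z = d (x ^+ l *: y)], where [x ^+ l *: y] has depth
    [l]. *)
Lemma deep_cycle_boundary n l : exists m, forall z : C (n + 1),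
  cdiff C (n + 1) z = 0 -> deep I m z ->
  exists2 y, deep I l y & cdiff C n y = z.
Proof.
have [||x xs|m mP] := @weak_artin_rees R s _ (cdiff C n @` deep I l)
  [set z : C (n + 1) | cdiff C (n + 1) z = 0] (@accC _) (@projC _).
- exact: submodule_image (deep_submodule I _ l).
- exact: cycle_submodule.
- have [k kP] := killC xs n; exists (l + k)%N => z /kP[y yz].
  exists (x ^+ l *: y); last by rewrite linearZ_LR /= yz scalerA exprD.
  by apply: deepX; apply: sub_span.
by exists m => z dz dpz; have [y] := mP z (conj dz dpz); exists y.
Qed.

Lemma approx_diff n m u (x : C n) : approx m u x ->
  approx m (cdiff (cotimes C (completion I)) n u) (cdiff C n x).
Proof. exact: approx_map. Qed.

Lemma approx_cotimes n m (x : C n) :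
  approx m (cotimes_map C (to_completion I) n x) x.
Proof.
rewrite [X in approx m X](_ : _ = tmul x (to_completion I (1 : R^o))).
  exact: approx_tmul.
exact: tensor_mapE.
Qed.

Lemma approx0 (M : lmodType R) m : approx m (0 : tensor M (completion I)) 0.
Proof. by move=> f; rewrite !raddf0. Qed.

(** If [x] approximates [u] to high order, then [d x] is a deep cycle, so it equals [d w] with [w]
    of depth [m]; correct [x] to [x - w]. *)
Lemma approx_cycle n m (u : cotimes C (completion I) n) :
  cdiff (cotimes C (completion I)) n u = 0 ->
  exists z, cdiff C n z = 0 /\ approx m u z.
Proof.
move=> du; have [k kP] := deep_cycle_boundary n m.
have [x ux] := approx_exists (maxn m k) u (projC n).
have [||w dw wx] := kP (cdiff C n x); first exact: cdiffK.
  have := approx_diff (approxW (leq_maxr m k) ux); rewrite du => dux.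
  by have := approx_deep dux (@approx0 _ k); rewrite subr0.
exists (x - w); split; first by rewrite raddfB /= wx subrr.
by apply: (deep_approx (approxW (leq_maxl m k) ux)); rewrite opprB addrC subrK.
Qed.

Theorem cotimes_completion_quasi_iso :
  quasi_iso (cotimes_map C (to_completion I)).
Proof.
apply: quasi_isoI => n.
  (* Injectivity: for a truncation [y] of [u] to order [m], the cycle [z - d y] is deep enough to be
     a boundary. Depth [0] imposes nothing on the bounding chain. *)
  move=> z u dz uz; have [m mP] := deep_cycle_boundary n 0.
  have [y uy] := approx_exists m u (projC n).
  have dzy : deep I m (z - cdiff C n y).
    apply: approx_deep (approx_cotimes m z) _.
    by rewrite -uz; apply: approx_diff.
  have [|w _ wE] := mP _ _ dzy; first by rewrite raddfB /= dz cdiffK subrr.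
  by exists (w + y); rewrite raddfD /= wE subrK.
move=> u du.
have /choice[g gP] := fun l => deep_cycle_boundary n l.
(* [h] is nondecreasing and dominates [g], so that [z l.+1 - z l] bounds a chain of depth [l]; it
   dominates the identity, so that [z l] tends to [u]. *)
pose h := fix h l := if l is l'.+1 then maxn (h l') (maxn l (g l)) else g 0%N.
have hS l : (h l <= h l.+1)%N by exact: leq_maxl.
have hg l : (g l <= h l)%N by case: l => //= l; rewrite !leq_max leqnn !orbT.
have hl l : (l <= h l)%N by case: l => //= l; rewrite !leq_max leqnn !orbT.
have /choice[z zP] := fun l => approx_cycle (h l) du.
have /choice[y yP] l : exists y, deep I l y /\ cdiff C n y = z l.+1 - z l.
  have [||y dy yz] := gP l (z l.+1 - z l).
  - by rewrite raddfB /= (zP _).1 (zP _).1 subrr.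
  - apply: (deepW (hg l)); apply: approx_deep (zP l).2.
    exact: approxW (hS l) (zP l.+1).2.
  - by exists y.
have [v vP] := approx_series (projC n) (fun l => (yP l).1).
exists (z 0%N), v; split; first exact: (zP _).1.
(* Both sides are limits of the sequence [z]: the left one by the choice of [z], the right one by
   telescoping. *)
apply: (@approx_inj R I _ _ _ z (projC (n + 1))) => m.
  exact: approxW (hl m) (zP m).2.
have -> : z m = z 0%N + cdiff C n (\sum_(l < m) y l).
  rewrite linear_sum (eq_bigr (fun l : 'I_m => z l.+1 - z l)).
    rewrite -(big_mkord xpredT (fun l => z l.+1 - z l)).
    by rewrite telescope_sumr // subrKC.
  by move=> l _; rewrite (yP l).2.
by apply: approxD; [exact: approx_cotimes | exact/approx_diff].
Qed.

End Completeness.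

(** * Tensoring with [kos1 a] as the cone of multiplication by [a] *)

Section KoszulStep.
Variables (R : comPzRingType) (a : R) (K : complex R).
Local Notation T := (tensor_complex (kos1 a) K).

Lemma stalk_trivial (M : lmodType R) n (x y : stalk M n) : n != 0 -> x = y.
Proof.
by case: n x y => [[|n]|n] //= x y _; rewrite (thinmx0 x) (thinmx0 y).
Qed.

(** As [kos1 a] lives in degrees -1 and 0, only the bidegrees [(0, n)] and [(-1, n + 1)] contribute
    in total degree [n]. *)
Definition ideg0 n : bideg n := @Bideg n (0, n) (introT eqP (add0r n)).

Lemma ideg1_subproof (n : int) : -1 + (n + 1) == n.
Proof. by rewrite addrC addrK. Qed.

Definition ideg1 n : bideg n := @Bideg n (-1, n + 1) (ideg1_subproof n).

(** The generators of [kos1 a]. The target of multiplication by [a] is the second component in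
    degree 0, the source is the first component in degree -1. *)
Definition kos1_top : kos1 a 0 := ((0 : 'rV[R]_0), (1 : R^o)).
Definition kos1_bot : kos1 a (-1) := ((1 : R^o), (0 : 'rV[R]_0)).

(* [kos1 a (x) K] is the cone of multiplication by [a] on [K]. *)
Definition cone_in n (u : (K (n + 1)%R * K n)%type) : T n :=
  inj (ideg1 n) (tmul kos1_bot u.1) + inj (ideg0 n) (tmul kos1_top u.2).

Lemma cone_in_is_linear n : linear (@cone_in n).
Proof.
move=> b u v; rewrite /cone_in /= !tmulDr !tmulZr !raddfD /= !linearZ_LR /=.
exact: addrACA.
Qed.
HB.instance Definition _ n :=
  GRing.isLinear.Build R (K (n + 1)%R * K n)%type (T n) _ (@cone_in n)
    (@cone_in_is_linear n).

Definition form_bot : {linear kos1 a (-1) -> R^o} := fst.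
Definition form_top : {linear kos1 a 0 -> R^o} := snd.

Definition cone_out n (t : T n) : (K (n + 1)%R * K n)%type :=
  (contr form_bot (t (ideg1 n)), contr form_top (t (ideg0 n))).

Lemma cone_out_is_linear n : linear (@cone_out n).
Proof.
by move=> b u v; congr pair; rewrite /= dprodDE dprodZE linearP.
Qed.
HB.instance Definition _ n := GRing.isLinear.Build R (T n)
  (K (n + 1)%R * K n)%type _ (@cone_out n) (@cone_out_is_linear n).

Lemma ideg_neq n : ideg1 n <> ideg0 n.
Proof. by move/(congr1 (@fdeg n)). Qed.

Lemma cone_out_bot n v : cone_out (inj (ideg1 n) v) = (contr form_bot v, 0).
Proof.
rewrite /cone_out injE inj_neq; first by rewrite raddf0.
exact: ideg_neq.
Qed.

Lemma cone_out_top n v : cone_out (inj (ideg0 n) v) = (0, contr form_top v).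
Proof.
rewrite /cone_out injE inj_neq; first by rewrite raddf0.
by move/esym; apply: ideg_neq.
Qed.

Lemma cone_inK n : cancel (@cone_in n) (@cone_out n).
Proof.
move=> [y z]; rewrite /cone_in raddfD /= cone_out_bot cone_out_top !contrE.
by congr pair; rewrite /= ?scale1r ?addr0 ?add0r.
Qed.

Lemma kos1_botP (x : kos1 a (-1)) : x = (form_bot x : R) *: kos1_bot.
Proof.
case: x => x y; congr pair.
  2: exact: (@stalk_trivial (R^o : lmodType R) (-1)).
by rewrite /= /GRing.scale /= mulr1.
Qed.

Lemma kos1_topP (x : kos1 a 0) : x = (form_top x : R) *: kos1_top.
Proof.
case: x => x y; congr pair; first exact: (@stalk_trivial (R^o : lmodType R) 1).
by rewrite /= /GRing.scale /= mulr1.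
Qed.

Lemma kos1_trivial (p : int) (x : kos1 a p) : p != 0 -> p != -1 -> x = 0.
Proof.
case: x => x y p0 p1; congr pair; apply: stalk_trivial => //.
by rewrite addr_eq0.
Qed.

(** It suffices to treat a pure tensor in one bidegree: its left factor is a multiple of [kos1_top]
    or [kos1_bot], or zero. *)
Lemma cone_outK n : cancel (@cone_out n) (@cone_in n).
Proof.
apply: (dsum_ind_ext (f := @cone_in n \o @cone_out n : {linear _ -> _})
  (g := idfun)) => i v.
apply: (tensor_ext (f := (@cone_in n \o @cone_out n) \o inj i : {linear _ -> _})
  (g := inj i : {linear _ -> _})) => x y /=.
case: i x y {v} => -[p q] e x y; rewrite /fdeg /sdeg /= in x y *.
have [p0|p0] := eqVneq p 0.
  subst p; have qn : q = n by rewrite -(eqP e) add0r.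
  subst q; rewrite (inj_irr e (introT eqP (add0r n))) cone_out_top contrE.
  rewrite /cone_in tmul0r raddf0 [LHS]add0r [in RHS](kos1_topP x).
  by rewrite tmulZl tmulZr.
have [p1|p1] := eqVneq p (-1).
  subst p; have qn : q = n + 1 by rewrite -(eqP e) addrC addNKr.
  subst q; rewrite (inj_irr e (ideg1_subproof n)) cone_out_bot contrE.
  rewrite /cone_in tmul0r raddf0 [LHS]addr0 [in RHS](kos1_botP x).
  by rewrite tmulZl tmulZr.
by rewrite (kos1_trivial x p0 p1) tmul0l !raddf0.
Qed.

Lemma kos1_diff_bot : cdiff (kos1 a) (-1) kos1_bot = a *: kos1_top.
Proof.
congr pair; first exact: (@stalk_trivial (R^o : lmodType R) 1).
exact: addr0.
Qed.

Lemma kos1_diff_top : cdiff (kos1 a) 0 kos1_top = 0.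
Proof. exact: kos1_trivial. Qed.

(** The term [a *: y] comes from [d kos1_bot = a *: kos1_top], the minus sign from the odd degree of
    [kos1_bot]. *)
Lemma cone_in_diff n (y : K (n + 1)) (z : K n) :
  cdiff T n (cone_in (y, z)) = cone_in (- cdiff K _ y, a *: y + cdiff K _ z).
Proof.
rewrite raddfD /= !tdiffE.
rewrite -[cdiff _ (fdeg (ideg1 n)) _]/(cdiff (kos1 a) (-1) kos1_bot).
rewrite -[cdiff _ (fdeg (ideg0 n)) _]/(cdiff (kos1 a) 0 kos1_top).
rewrite kos1_diff_bot kos1_diff_top tmul0l raddf0 add0r.
rewrite expr1 expr0 scale1r scaleN1r -raddfN tmulZl -tmulZr.
(* The raised bidegrees agree with [ideg0 (n + 1)] and [ideg1 (n + 1)] up to the proof that they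
   carry. *)
have e1 (v : tensor (kos1 a 0) (K (n + 1))) :
  inj (bsl (ideg1 n)) v = inj (ideg0 (n + 1)) v := inj_irr _ _ v.
have e2 (v : tensor (kos1 a (-1)) (K (n + 1 + 1))) :
  inj (bsr (ideg1 n)) v = inj (ideg1 (n + 1)) v := inj_irr _ _ v.
have e3 (v : tensor (kos1 a 0) (K (n + 1))) :
  inj (bsr (ideg0 n)) v = inj (ideg0 (n + 1)) v := inj_irr _ _ v.
rewrite /= e1 e2 e3 /cone_in /= tmulDr raddfD /=.
rewrite [X in X + _ = _]addrC -addrA; congr (inj _ _ + _).
by rewrite -!scaleN1r tmulZr.
Qed.

Lemma acc_tensor_kos1 n : acc (K (n + 1)) -> acc (K n) -> acc (T n).
Proof.
move=> aK1 aK; apply: (acc_surj (f := @cone_in n : {linear _ -> _})).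
  by move=> t; exists (cone_out t); apply: cone_outK.
exact: acc_prod.
Qed.

Lemma fg_projective_tensor_kos1 n :
  fg_projective (K (n + 1)) -> fg_projective (K n) -> fg_projective (T n).
Proof.
move=> pK1 pK; apply: (fg_projective_retract (f := @cone_in n : {linear _ -> _})
  (g := @cone_out n : {linear _ -> _})).
  exact: cone_outK.
exact: fg_projective_prod.
Qed.

Lemma cone_cycle n y z : cdiff T n (cone_in (y, z)) = 0 ->
  cdiff K (n + 1) y = 0 /\ a *: y + cdiff K n z = 0.
Proof.
rewrite cone_in_diff => /(congr1 (@cone_out (n + 1))).
by rewrite cone_inK raddf0 => -[/eqP]; rewrite oppr_eq0 => /eqP.
Qed.

(** The map sending [(y, z)] to [(z, 0)] is a null-homotopy of multiplication by [a] on the cone. *)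
Lemma homology_killed_self : homology_killed T a.
Proof.
move=> n; exists 1%N => t; rewrite -[t]cone_outK.
case: (cone_out t) => y z /cone_cycle[_ ayz].
exists (cone_in (z, 0)); rewrite cone_in_diff expr1 -linearZ /=.
congr cone_in; congr pair; last by rewrite raddf0 addr0.
by apply/esym/eqP; rewrite -addr_eq0; apply/eqP.
Qed.

(** The long exact sequence of the cone on elements: the exponents for the two neighbouring degrees
    of [K] add up. *)
Lemma homology_killed_tensor x : homology_killed K x -> homology_killed T x.
Proof.
move=> hx n; have [k kP] := hx (n + 1); have [l lP] := hx n.
exists (l + k)%N => t; rewrite -[t]cone_outK.
case: (cone_out t) => y z /cone_cycle[dy ayz].
have [w wy] := kP y dy.
(* The term [a *: w] makes this a cycle: its differential is [x ^+ k *: (a *: y + d z) = 0]. *)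
have [|v vz] := lP (x ^+ k *: z + a *: w).
  rewrite raddfD /= !linearZ_LR /= wy scalerA mulrC -scalerA -scalerDr.
    by rewrite [X in _ *: X]addrC ayz scaler0.
exists (cone_in (- (x ^+ l *: w), v)); rewrite cone_in_diff -[RHS]linearZ /=.
congr cone_in; congr pair.
  by rewrite /= (raddfN (cdiff K _)) /= linearZ_LR opprK /= wy scalerA exprD.
rewrite /= vz scalerN scalerDr !scalerA -exprD [a * _]mulrC.
by rewrite addrCA addNr addr0.
Qed.

End KoszulStep.

(** * Koszul complexes over a noetherian ring *)

Section Koszul.
Variables (R : comPzRingType) (hR : noetherian R).
Implicit Types s : seq R.

Lemma acc_kos s n : acc (kos s n).
Proof.
elim: s n => [|a s IH] n; last exact: acc_tensor_kos1.
have [-> /=|n0] := eqVneq n 0; first exact: noetherian_acc.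
by apply: acc_trivial => x; apply: stalk_trivial.
Qed.

Lemma fg_projective_kos s n : fg_projective (kos s n).
Proof.
elim: s n => [|a s IH] n; last exact: fg_projective_tensor_kos1.
have [-> /=|n0] := eqVneq n 0; first exact: fg_projective_regular.
by apply: fg_projective_trivial => x; apply: stalk_trivial.
Qed.

(** The head of [s] acts null-homotopically on the cone that it introduces; for the tail, the
    property survives passing to the cone. *)
Lemma homology_killed_kos s x : x \in s -> homology_killed (kos s) x.
Proof.
elim: s => // a s IH; rewrite inE => /orP[/eqP ->|/IH].
  exact: homology_killed_self.
exact: homology_killed_tensor.
Qed.

End Koszul.

Theorem proposition3p17 (R : comPzRingType) (hR : noetherian R) (s : seq R) :
  koszul_complete s.
Proof.
apply: cotimes_completion_quasi_iso => [n|n|x].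
- exact: acc_kos.
- exact: fg_projective_kos.
- exact: homology_killed_kos.
Qed.
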